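(* There exist absolute constants $C>0$ and $c>0$ such that the following holds for every integer $n\ge 2$ and every $0<\delta<1$. There exist $\varepsilon\in(0,1]$ and a reference distribution $\mathbf{q}$ over $[n]$ such that any algorithm which, given $\mathbf{q}$, $\varepsilon$, $\delta$, and i.i.d. samples from an unknown distribution $\mathbf{p}\in\Pi_n(\mathbf{q})$, distinguishes with probability at least $2/3$ between (i) $d_{\mathrm{TV}}(\mathbf{p},\mathbf{q})\le\varepsilon$ and (ii) $d_{\mathrm{TV}}(\mathbf{p},\mathbf{q})>\varepsilon+\delta$, must use at least $c\,\delta^2\, n^{1-C/\log(1/\delta)}$ samples.
   Context: $[n]=\{1,\dots,n\}$, $\mathcal{S}_n$ is the set of permutations of $[n]$, and a probability distribution over $[n]$ is identified with its probability mass function $[n]\to[0,1]$. Logarithms are to base 2. For a distribution $\mathbf{q}$ over $[n]$, $\Pi_n(\mathbf{q})=\{\mathbf{q}\circ\pi : \pi\in\mathcal{S}_n\}$ is the set of distributions equal to $\mathbf{q}$ up to a permutation of the domain. The total variation distance is $d_{\mathrm{TV}}(\mathbf{p},\mathbf{q})=\sup_{S\subseteq[n]}(\mathbf{p}(S)-\mathbf{q}(S))=\frac12\sum_{i=1}^n|\mathbf{p}(i)-\mathbf{q}(i)|$. An algorithm using $s$ samples is a (possibly randomized) map from $[n]^s$ to $\{\mathsf{yes},\mathsf{no}\}$, applied to $s$ i.i.d. samples from $\mathbf{p}$; it may depend on $n$, $\mathbf{q}$ and the parameters but not on $\mathbf{p}$. It distinguishes between (i) and (ii) with probability at least $2/3$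 if, for every $\mathbf{p}\in\Pi_n(\mathbf{q})$ satisfying (i), it outputs $\mathsf{yes}$ with probability at least $2/3$, and for every $\mathbf{p}\in\Pi_n(\mathbf{q})$ satisfying (ii), it outputs $\mathsf{no}$ with probability at least $2/3$ (probability over the samples and the internal randomness); no requirement is made for other $\mathbf{p}$. *)

(* Defs.v *)
From HB Require Import structures.
From mathcomp Require Import all_boot all_order all_algebra all_fingroup.
From mathcomp Require Import all_classical all_reals all_analysis.

Set Implicit Arguments.
Unset Strict Implicit.
Unset Printing Implicit Defensive.

Import Order.TTheory GRing.Theory Num.Theory.

Local Open Scope ring_scope.

Record dist (R : realType) (T : finType) := Dist {
  dist_pmf :> T -> R;
  dist_ge0 : forall x, 0 <= dist_pmf x;
  dist_sum1 : \sum_x dist_pmf x = 1 }.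

Definition dTV (R : realType) (n : nat) (p q : dist R 'I_n) : R :=
  2^-1 * \sum_i `|p i - q i|.

Lemma dTV_sup (R : realType) (n : nat) (p q : dist R 'I_n) :
  dTV p q =
  sup [set \sum_(i in S) p i - \sum_(i in S) q i | S in [set: {set 'I_n}]]%classic.
Proof.
set f := fun S : {set 'I_n} => \sum_(i in S) p i - \sum_(i in S) q i.
have fE S : f S = \sum_(i in S) (p i - q i) by rewrite /f -sumrB.
pose P := [set i | q i <= p i]%SET.
have fP : dTV p q = f P.
  have s0 : \sum_i (p i - q i) = 0 by rewrite sumrB !dist_sum1 subrr.
  rewrite /dTV (bigID (fun i => i \in P)) /=.
  rewrite (eq_bigr (fun i => p i - q i)); last first.
    by move=> i; rewrite inE => le; rewrite ger0_norm // subr_ge0.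
  rewrite [X in _ + X](eq_bigr (fun i => - (p i - q i))); last first.
    by move=> i; rewrite inE -ltNge => /ltW le; rewrite ler0_norm // subr_le0.
  rewrite sumrN -fE.
  have -> : \sum_(i | i \notin P) (p i - q i) = - f P.
    apply/eqP; rewrite -addr_eq0 addrC fE.
    by rewrite -[X in _ == X]s0 [X in _ == X](bigID (fun i => i \in P)).
  by rewrite opprK -mulr2n -[f P *+ 2]mulr_natl mulKf // pnatr_eq0.
have ub S : f S <= f P.
  rewrite !fE (big_setID P) /= [leRHS](big_setID S) /= finset.setIC.
  apply: lerD => //; apply: (@le_trans _ _ 0).
    apply: sumr_le0 => i; rewrite !inE -ltNge => /andP[/ltW le _].
    by rewrite subr_le0.
  by apply: sumr_ge0 => i; rewrite !inE => /andP[_ le]; rewrite subr_ge0.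
apply/eqP; rewrite eq_le fP; apply/andP; split.
  apply: ub_le_sup; last by exists P.
  by exists (f P) => _ [S _ <-]; exact: ub.
by apply: ge_sup; [exists (f P), P | move=> _ [S _ <-]; exact: ub].
Qed.

Definition perm_class (R : realType) (n : nat) (q p : dist R 'I_n) : Prop :=
  exists sigma : 'S_n, forall i, p i = q (sigma i).

(* A randomized map [n]^s -> {yes, no}: each sample sequence is sent to the law
   of the answer, with [true] for yes and [false] for no. *)
Definition algorithm (R : realType) (n s : nat) : Type :=
  {ffun 'I_s -> 'I_n} -> dist R bool.

(* Probability that A answers b on s i.i.d. samples from p, over both the
   samples and the internal randomness of A. *)
Definition prob_output (R : realType) (n s : nat) (A : algorithm R n s)
    (p : dist R 'I_n) (b : bool) : R :=
  \sum_(x : {ffun 'I_s -> 'I_n}) (\prod_(j < s) p (x j)) * A x b.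

Definition distinguishes (R : realType) (n s : nat) (q : dist R 'I_n)
    (eps delta : R) (A : algorithm R n s) : Prop :=
  forall p : dist R 'I_n, perm_class q p ->
    (dTV p q <= eps -> 2 / 3 <= prob_output A p true) /\
    (eps + delta < dTV p q -> 2 / 3 <= prob_output A p false).

Definition log2 (R : realType) (x : R) : R := ln x / ln 2.

(* Main.v *)
Require Import Defs.
From HB Require Import structures.
From mathcomp Require Import all_boot all_order all_algebra all_fingroup.
From mathcomp Require Import all_classical all_reals all_analysis.
From mathcomp Require Import ring lra.

Set Implicit Arguments.
Unset Strict Implicit.
Unset Printing Implicit Defensive.

Import Order.TTheory GRing.Theory Num.Theory.

Local Open Scope ring_scope.

(** Let V = {0,1}^K be a cube.  The symbols are grouped into N cells; a symbol
    is a triple (a, x, z): a cell a, a point x of V and a point z of V of even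
    parity.  Under the model q its probability is proportional to the Hamming
    weight |x|.  Given one shift r_a in V for each cell, the involution
    (a, x, z) |-> (a, x + z + r_a, z) relabels q into the distribution p_r in
    which (a, x, z) has probability proportional to |x + z + r_a|.

    - Distance.  When r_a is even, z + r_a runs over all the even points as z
      does; when r_a is odd, over all the odd points.  Hence d_TV(p_r, q) takes
      one value if every r_a is even and another one if every r_a is odd
      ([dTV_relabeled]).  The difference of the two is a signed sum of
      | |x| - |y| | over V x V; writing |a - b| as a sum over thresholds of
      squared differences of indicators turns it into a sum of squares, one of
      which is visibly nonzero ([sign_energy]).  The gap is at least
      1 / (K 4^K) ([layer_dist_gap]).

    - Indistinguishability.  Draw r uniformly among the families of even shifts,
      or among the families of odd shifts.  The probability of seeing given
      samples is a product of weights; expand each weight as the sum of its K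
      bits.  In a cell with fewer than K samples, each term of the expansion
      leaves out some bit, and flipping that bit of r_a exchanges even and odd
      shifts without changing the term.  So the two mixtures agree exactly on
      the sample sequences that put fewer than K samples in every cell
      ([sparse_likelihood]).  Every cell has probability 1 / N whatever r is, so
      the other sequences have probability at most s^K / N^(K-1)
      ([collision_mass]).  An algorithm which is right with probability 2/3 in
      both cases therefore needs N^(K-1) <= 3 s^K ([sample_lower_bound]).

    For the theorem, take 16^K of the order of 1 / delta, so that the gap
    exceeds 2 delta and K is of the order of log (1 / delta), and N of the order
    of n / 4^K.  Then s >= (N^(K-1) / 3)^(1/K), where the exponent 1 - 1/K gives
    n^(1 - C / log (1 / delta)) and the factor delta^2 pays for 4^K.  When the
    claimed bound is at most 1, it only says that one sample is needed, which
    two point masses show ([at_least_one_sample]). *)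

(** * The cube and the Hamming weight *)

Notation cube k := {ffun 'I_k -> bool}.

Definition weight (k : nat) (x : cube k) : nat := (\sum_i x i)%N.

Definition parity (k : nat) (x : cube k) : bool := \big[addb/false]_i x i.

Definition axis (k : nat) (i : 'I_k) : cube k := [ffun j => j == i].

Lemma cubeDE (k : nat) (x y : cube k) (i : 'I_k) :
  (x + y : cube k) i = x i (+) y i.
Proof. by rewrite ffunE. Qed.

Lemma cubeDD (k : nat) (x : cube k) : x + x = 0.
Proof. by apply/ffunP => i; rewrite cubeDE addbb ffunE. Qed.

Lemma parityD (k : nat) (x y : cube k) :
  parity (x + y) = parity x (+) parity y.
Proof.
by rewrite /parity -big_split /=; apply: eq_bigr => i _; rewrite cubeDE.
Qed.

Lemma parity_axis (k : nat) (i : 'I_k) : parity (axis i).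
Proof.
rewrite /parity (bigD1 i) //= big1 ?addbF ?ffunE ?eqxx // => j /negbTE ji.
by rewrite ffunE ji.
Qed.

Lemma weight_le (k : nat) (x : cube k) : (weight x <= k)%N.
Proof.
rewrite -[leqRHS]card_ord -sum1_card; apply: leq_sum => i _.
by case: (x i).
Qed.

Lemma weight_full (k : nat) (x : cube k) :
  (k <= weight x)%N = (x == [ffun=> true]).
Proof.
apply/idP/eqP => [kx | ->]; last first.
  rewrite /weight -[leqLHS]card_ord -sum1_card leq_sum // => i _.
  by rewrite ffunE.
apply/ffunP => i; rewrite ffunE; apply/negP => /negP/negbTE xi.
move: kx; rewrite leqNgt => /negP; apply.
rewrite /weight (bigD1 i) //= xi add0n -[X in (_ < X)%N]card_ord -sum1_card.
rewrite [X in (_ < X)%N](bigD1 i) //= add1n ltnS leq_sum // => j _.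
by case: (x j).
Qed.

(** Translation by one basis vector changes every sign. *)
Lemma sum_sign (R : realType) (k : nat) :
  \sum_(x : cube k.+1) (-1) ^+ parity x = 0 :> R.
Proof.
set S := (X in X = 0).
suff : S = - S by move=> h; lra.
rewrite /S -sumrN (reindex_inj (addIr (axis ord0))) /=; apply: eq_bigr => x _.
by rewrite parityD signr_addb parity_axis expr1 mulrN1.
Qed.

Lemma sum_threshold (K a : nat) : (a <= K)%N ->
  (\sum_(t < K) (t < a) = a)%N.
Proof.
move=> aK; rewrite -[RHS]card_ord -sum1_card (big_ord_widen _ (fun=> 1%N) aK).
by rewrite [RHS]big_mkcond; apply: eq_bigr => i _; case: (_ < _)%N.
Qed.

(** The distance between two integers becomes a sum of squares, which
    diagonalizes the kernel |a - b| in [sign_energy]. *)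
Lemma dist_thresholdE (R : realType) (K a b : nat) : (a <= K)%N -> (b <= K)%N ->
  `|a%:R - b%:R| = \sum_(t < K) ((t < a)%N%:R - (t < b)%N%:R) ^+ 2 :> R.
Proof.
wlog ab : a b / (a <= b)%N => [H|] aK bK.
  case/orP: (leq_total a b) => ab; first exact: H.
  by rewrite distrC H //; apply: eq_bigr => t _; rewrite -sqrrN opprB.
rewrite ler0_norm ?subr_le0 ?ler_nat // opprB.
rewrite -{1}(sum_threshold aK) -{1}(sum_threshold bK) !natr_sum -sumrB.
apply: eq_bigr => t _.
have [ta|_] := ltnP t a; last first.
  by rewrite sub0r sqrrN -natrX; case: (_ < _)%N; rewrite subr0.
by rewrite (leq_trans ta ab) subrr expr0n.
Qed.

(** Expand the distance over thresholds.  In (u - v)^2 = u + v - 2 u v, for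
    indicators u and v, the terms u and v vanish because the signs add up to 0
    over the cube; each threshold contributes -2 times a square.  At the largest
    threshold only the point with all bits set has enough weight, so that square
    is 1. *)
Lemma sign_energy (R : realType) (k : nat) :
  \sum_(x : cube k.+1) \sum_(y : cube k.+1)
     (-1) ^+ parity x * (-1) ^+ parity y
       * `|(weight x)%:R - (weight y)%:R| <= -2 :> R.
Proof.
pose s (x : cube k.+1) : R := (-1) ^+ parity x.
pose u (t : 'I_k.+1) (x : cube k.+1) : R := (t < weight x)%N%:R.
have s0 : \sum_x s x = 0 by exact: sum_sign.
have uu t x : u t x ^+ 2 = u t x.
  by rewrite /u; case: (_ < _)%N; rewrite ?expr1n ?expr0n.
have -> : \sum_(x : cube k.+1) \sum_(y : cube k.+1)
     (-1) ^+ parity x * (-1) ^+ parity y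
       * `|(weight x)%:R - (weight y)%:R| =
    \sum_(t < k.+1) (-2 * (\sum_x s x * u t x) ^+ 2).
  transitivity (\sum_t \sum_x \sum_y
      (s x * u t x * s y + s x * (s y * u t y) +
       -2 * ((s x * u t x) * (s y * u t y)))).
    rewrite [RHS]exchange_big /=; apply: eq_bigr => x _.
    rewrite [RHS]exchange_big /=; apply: eq_bigr => y _.
    rewrite (dist_thresholdE _ (weight_le x) (weight_le y)) mulr_sumr.
    apply: eq_bigr => t _; rewrite -/(u t x) -/(u t y).
    rewrite sqrrB !uu -/(s x) -/(s y).
    ring.
  apply: eq_bigr => t _.
  under eq_bigr => x _ do rewrite !big_split /= -!mulr_sumr s0 mulr0 add0r.
  by rewrite big_split /= -mulr_suml s0 mul0r add0r -mulr_sumr -mulr_suml expr2.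
(* All thresholds but the last one contribute a nonpositive amount. *)
rewrite big_ord_recr /=.
have -> : \sum_x s x * u ord_max x = s [ffun=> true].
  rewrite (bigD1 [ffun=> true]) //= big1 ?addr0.
    by rewrite /u /= weight_full eqxx mulr1.
  by move=> x; rewrite -weight_full /u /= => /negbTE ->; rewrite mulr0.
rewrite sqrr_sign mulr1 gerDr; apply: sumr_le0 => t _.
by rewrite mulNr oppr_le0 mulr_ge0 ?sqr_ge0.
Qed.

(** * Samples carry no information until some cell is hit K times *)

Definition all_parity (N k : nat) (b : bool)
    (r : {ffun 'I_N -> cube k}) : bool :=
  [forall a, parity (r a) == b].

(** Translation by [v] is a bijection between the families of even shifts and
    the families of odd shifts. *)
Lemma sum_even_odd (R : realType) (N k : nat) (v : {ffun 'I_N -> cube k})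
    (F : {ffun 'I_N -> cube k} -> R) :
  (forall a, parity (v a)) -> (forall r, F (r + v) = F r) ->
  \sum_(r | all_parity false r) F r = \sum_(r | all_parity true r) F r.
Proof.
move=> pv Fv; rewrite [RHS](reindex_inj (addIr v)) /=.
apply: eq_big => [r|r _]; last by rewrite Fv.
by apply: eq_forallb => a; rewrite ffunE parityD pv; case: (parity _).
Qed.

Definition sparse (n N K s : nat) (c : 'I_n -> 'I_N)
    (w : {ffun 'I_s -> 'I_n}) : bool :=
  [forall a, #|[set j | c (w j) == a]| < K]%N.

(** Both sides expand into sums over the choices [f] of one bit for each sample.
    For a fixed [f], every cell has a bit that none of its samples looks at
    ([free]), and flipping these bits is the bijection of [sum_even_odd]. *)
Lemma sparse_likelihood (R : realType) (n N k s : nat) (m : 'I_n -> R)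
    (y : 'I_n -> cube k.+1) (c : 'I_n -> 'I_N) (w : {ffun 'I_s -> 'I_n}) :
  sparse k.+1 c w ->
  \sum_(r | all_parity false r)
     \prod_j (m (w j) * (weight (y (w j) + r (c (w j))))%:R) =
  \sum_(r | all_parity true r)
     \prod_j (m (w j) * (weight (y (w j) + r (c (w j))))%:R).
Proof.
move=> /forallP sp.
have expand (r : {ffun 'I_N -> cube k.+1}) :
    \prod_j (m (w j) * (weight (y (w j) + r (c (w j))))%:R) =
    \sum_(f : {ffun 'I_s -> 'I_k.+1})
      \prod_j (m (w j) * ((y (w j) + r (c (w j)) : cube k.+1)%R (f j))%:R).
  rewrite -(bigA_distr_bigA (fun j i =>
    m (w j) * ((y (w j) + r (c (w j)) : cube k.+1)%R i)%:R)).
  by apply: eq_bigr => j _; rewrite /weight natr_sum mulr_sumr.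
under eq_bigr do rewrite expand.
under [RHS]eq_bigr do rewrite expand.
rewrite exchange_big [RHS]exchange_big /=; apply: eq_bigr => f _.
pose busy a := f @: [set j | c (w j) == a].
pose free a := odflt ord0 [pick i | i \notin busy a].
have freeP a : free a \notin busy a.
  rewrite /free; case: pickP => //= all_busy.
  have /eqP busyT : busy a == [set: 'I_k.+1]%SET.
    by apply/eqP/finset.setP => i; rewrite inE; have /negbFE := all_busy i.
  have := leq_imset_card f [set j | c (w j) == a].
  by rewrite -/(busy a) busyT finset.cardsT card_ord leqNgt sp.
apply: (sum_even_odd (v := [ffun a => axis (free a)])) => [a | r].
  by rewrite ffunE parity_axis.
apply: eq_bigr => j _; congr (_ * _%:R).
rewrite !cubeDE !ffunE [X in _ (+) X]/GRing.add /=.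
have /negbTE -> : f j != free (c (w j)).
  apply: contraNneq (freeP (c (w j))) => <-.
  by apply: imset_f; rewrite inE.
by rewrite addbF.
Qed.

Lemma sum_samples (R : realType) (n s : nat) (F : 'I_s -> 'I_n -> R) :
  \sum_(w : {ffun 'I_s -> 'I_n}) \prod_j F j (w j) = \prod_j \sum_i F j i.
Proof. by rewrite -(bigA_distr_bigA F). Qed.

(** The samples sharing a cell are listed by an injection [t] because functions
    are easy to count in the union bound of [collision_mass]. *)
Lemma collision_witness (n N K s : nat) (c : 'I_n -> 'I_N)
    (w : {ffun 'I_s -> 'I_n}) :
  ~~ sparse K c w ->
  exists a, exists2 t : {ffun 'I_K -> 'I_s},
    injectiveb t & forall i, c (w (t i)) = a.
Proof.
rewrite negb_forall => /existsP[a]; rewrite -leqNgt => Ka; exists a.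
exists [ffun i => enum_val (widen_ord Ka i)].
  apply/injectiveP => i j; rewrite !ffunE => /enum_val_inj /(congr1 val) /= ij.
  exact: val_inj.
by move=> i; rewrite ffunE; have := enum_valP (widen_ord Ka i);
  rewrite inE => /eqP.
Qed.

(** Union bound over the cell [a] and the K positions [t]: each of the at most
    N s^K events has probability N^-K. *)
Lemma collision_mass (R : realType) (n N K s : nat) (c : 'I_n -> 'I_N)
    (p : dist R 'I_n) : (0 < N)%N ->
  (forall a, \sum_(i | c i == a) p i = N%:R^-1) ->
  \sum_(w : {ffun 'I_s -> 'I_n} | ~~ sparse K c w) \prod_j p (w j) <=
  N%:R * s%:R ^+ K / N%:R ^+ K.
Proof.
move=> N0 pc.
pose hit (a : 'I_N) (t : {ffun 'I_K -> 'I_s}) j i : R :=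
  ((j \in codom t) ==> (c i == a))%:R.
have hit_ge0 a t j i : 0 <= p i * hit a t j i.
  by rewrite mulr_ge0 ?ler0n ?dist_ge0.
have bad_le (w : {ffun 'I_s -> 'I_n}) : ~~ sparse K c w ->
    \prod_j p (w j) <=
    \sum_(a < N) \sum_(t : {ffun 'I_K -> 'I_s} | injectiveb t)
      \prod_j (p (w j) * hit a t j (w j)).
  move=> /collision_witness[a [t tinj ta]].
  rewrite (bigD1 a) //= (bigD1 t) //= -addrA.
  have -> : \prod_j (p (w j) * hit a t j (w j)) = \prod_j p (w j).
    apply: eq_bigr => j _; rewrite /hit.
    case: (boolP (j \in codom t)) => [/codomP[i ->]|_]; last by rewrite mulr1.
    by rewrite ta eqxx mulr1.
  rewrite lerDl addr_ge0 //; last apply: sumr_ge0 => b _.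
    by apply: sumr_ge0 => u _; apply: prodr_ge0.
  by apply: sumr_ge0 => u _; apply: prodr_ge0.
apply: (@le_trans _ _ (\sum_(w : {ffun 'I_s -> 'I_n})
    \sum_(a < N) \sum_(t : {ffun 'I_K -> 'I_s} | injectiveb t)
      \prod_j (p (w j) * hit a t j (w j)))).
  rewrite big_mkcond; apply: ler_sum => w _; case: ifP => [/bad_le //|_].
  by do 2![apply: sumr_ge0 => ? _]; apply: prodr_ge0.
rewrite exchange_big /=.
have cell_prob (a : 'I_N) (t : {ffun 'I_K -> 'I_s}) : injectiveb t ->
    \sum_(w : {ffun 'I_s -> 'I_n}) \prod_j (p (w j) * hit a t j (w j)) =
    N%:R ^- K.
  move=> /injectiveP tinj; rewrite (sum_samples (fun j i => p i * hit a t j i)).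
  rewrite (bigID (mem (codom t))) /= [X in _ * X]big1 ?mulr1 => [|j /negbTE jt].
    rewrite (eq_bigr (fun=> N%:R^-1)) => [|j jt].
      by rewrite prodr_const card_codom // card_ord exprVn.
    rewrite -(pc a) [RHS]big_mkcond; apply: eq_bigr => i _.
    by rewrite /hit jt /=; case: eqP; rewrite ?mulr1 ?mulr0.
  by rewrite -[RHS](dist_sum1 p); apply: eq_bigr => i _; rewrite /hit jt mulr1.
apply: (@le_trans _ _ (\sum_(a < N) s%:R ^+ K / N%:R ^+ K)).
  apply: ler_sum => a _; rewrite exchange_big /=.
  rewrite (eq_bigr (fun=> N%:R ^- K)) => [|t /cell_prob //].
  rewrite sumr_const -[leLHS]mulr_natl ler_wpM2r ?invr_ge0 ?exprn_ge0 //.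
  by rewrite -natrX ler_nat (leq_trans (max_card _)) // card_ffun !card_ord.
by rewrite sumr_const card_ord -[leLHS]mulr_natl mulrA.
Qed.

Lemma samples_sum1 (R : realType) (n s : nat) (p : dist R 'I_n) :
  \sum_(w : {ffun 'I_s -> 'I_n}) \prod_j p (w j) = 1.
Proof.
rewrite (sum_samples (fun=> p)) big1 // => j _; exact: dist_sum1.
Qed.

Lemma answer_sum1 (R : realType) (d : dist R bool) : d true + d false = 1.
Proof. by rewrite -(dist_sum1 d) big_bool. Qed.

(** Le Cam's argument for two mixtures.  The average probability of a yes over
    the even families and that of a no over the odd families add up to at least
    4/3.  Sequences on which the two likelihoods agree contribute at most 1 in
    total, so the excess of 1/3 has to come from those that are not sparse. *)
Lemma sample_lower_bound (R : realType) (n N k s : nat) (m : 'I_n -> R)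
    (y : 'I_n -> cube k.+1) (c : 'I_n -> 'I_N)
    (P : {ffun 'I_N -> cube k.+1} -> dist R 'I_n) (A : algorithm R n s) :
  (0 < N)%N ->
  (forall r i, P r i = m i * (weight (y i + r (c i)))%:R) ->
  (forall r a, \sum_(i | c i == a) P r i = N%:R^-1) ->
  (forall r, all_parity false r -> 2 / 3 <= prob_output A (P r) true) ->
  (forall r, all_parity true r -> 2 / 3 <= prob_output A (P r) false) ->
  N%:R ^+ k <= 3 * s%:R ^+ k.+1 :> R.
Proof.
move=> N0 PE Pc Hyes Hno.
pose L b (w : {ffun 'I_s -> 'I_n}) : R :=
  \sum_(r | all_parity b r) \prod_j P r (w j).
have L_ge0 b w : 0 <= L b w.
  by apply: sumr_ge0 => r _; apply: prodr_ge0 => j _; apply: dist_ge0.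
have Lsparse w : sparse k.+1 c w -> L false w = L true w.
  move=> sp; have := sparse_likelihood m y sp.
  rewrite /L; under eq_bigr do under eq_bigr do rewrite -PE.
  by under [X in _ = X -> _]eq_bigr do under eq_bigr do rewrite -PE.
pose M : R := \sum_(r : {ffun 'I_N -> cube k.+1} | all_parity false r) 1.
have ME : M = \sum_(r : {ffun 'I_N -> cube k.+1} | all_parity true r) 1.
  apply: (sum_even_odd (v := [ffun=> axis ord0])) => // a.
  by rewrite ffunE parity_axis.
have M0 : 0 < M.
  rewrite /M (bigD1 [ffun=> [ffun=> false]]) /=; last first.
    by apply/forallP => a; rewrite ffunE /parity big1 // => i _; rewrite ffunE.
  by rewrite ltr_pwDl // sumr_ge0.
have probE b b' : \sum_(r | all_parity b r) prob_output A (P r) b' =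
    \sum_w L b w * A w b'.
  rewrite exchange_big /=; apply: eq_bigr => w _; by rewrite /L mulr_suml.
set beta : R := N%:R * s%:R ^+ k.+1 / N%:R ^+ k.+1.
have success : 2 / 3 * M + 2 / 3 * M <=
    \sum_w (L false w * A w true + L true w * A w false).
  rewrite big_split -!probE /=; apply: lerD.
    by rewrite /M mulr_sumr; apply: ler_sum => r /Hyes; rewrite mulr1.
  by rewrite ME mulr_sumr; apply: ler_sum => r /Hno; rewrite mulr1.
have failure : \sum_w (L false w * A w true + L true w * A w false) <=
    M + M * beta.
  (* The answers have total probability 1, so equal likelihoods pay once. *)
  apply: (@le_trans _ _ (\sum_w
    (L true w + if sparse k.+1 c w then 0 else L false w))).
    apply: ler_sum => w _; have := answer_sum1 (A w).
    have := dist_ge0 (A w) true; have := dist_ge0 (A w) false.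
    move: (L_ge0 true w) (L_ge0 false w) (@Lsparse w).
    case: (sparse _ _ _) => h1 h2 h3 h4 h5 h6; last nra.
    by rewrite h3 // -mulrDr h6 addr0 mulr1.
  rewrite big_split /=; apply: lerD.
    rewrite exchange_big /= ME le_eqVlt; apply/orP; left; apply/eqP.
    by apply: eq_bigr => r _; rewrite samples_sum1.
  under eq_bigr do rewrite -if_neg.
  rewrite -big_mkcond /= exchange_big /= /M mulr_suml; apply: ler_sum => r _.
  by rewrite mul1r; apply: collision_mass.
have : 1 / 3 <= beta by nra.
have Npos : 0 < N%:R :> R by rewrite ltr0n.
rewrite /beta ler_pdivlMr ?exprn_gt0 // exprS => h.
rewrite -(ler_pM2l Npos); lra.
Qed.

(** * The model and its relabelings *)

Lemma finite_encoding (T : finType) (t0 : T) (n : nat) : (#|T| <= n)%N ->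
  exists (f : T -> 'I_n) (g : 'I_n -> T), cancel f g.
Proof.
move=> Tn; pose f (t : T) := widen_ord Tn (enum_rank t).
exists f, (fun i => odflt t0 [pick t | f t == i]) => t.
case: pickP => [u /eqP /(congr1 val) /= fut | /(_ t)]; last by rewrite eqxx.
by apply: enum_rank_inj; apply: val_inj.
Qed.

(** The symbols are embedded in ['I_n] by [f] with left inverse [g]; the
    elements outside the image of [f] get probability 0. *)
Section HardInstance.

Variables (R : realType) (n N k : nat).
Hypothesis N_gt0 : (0 < N)%N.

Notation bits := (cube k.+1).
Notation symbol := ('I_N * (bits * bits))%type.

Variables (f : symbol -> 'I_n) (g : 'I_n -> symbol).
Hypothesis fK : cancel f g.

Let cell i := (g i).1.
Let base i : bits := (g i).2.1.
Let third i : bits := (g i).2.2.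

Definition even_count : R := \sum_(z : bits | ~~ parity z) 1.

Definition total_weight : R := \sum_(x : bits) (weight x)%:R.

(** The factor of the probability of a symbol that does not depend on the
    shifts: it selects the symbols whose third component is even, and
    normalizes. *)
Definition unit_mass (i : 'I_n) : R :=
  ((f (g i) == i) && ~~ parity (third i))%:R
    / (N%:R * (even_count * total_weight)).

Lemma even_count_gt0 : 0 < even_count.
Proof.
rewrite /even_count (bigD1 [ffun=> false]) /=.
  by rewrite ltr_pwDl // sumr_ge0.
by rewrite /parity big1 // => i _; rewrite ffunE.
Qed.

Lemma even_count_le : even_count <= 2 ^+ k.+1.
Proof.
apply: (@le_trans _ _ (\sum_(z : bits) 1)).
  by rewrite /even_count big_mkcond; apply: ler_sum => z _; case: ifP.
by rewrite sumr_const card_ffun card_bool card_ord natrX.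
Qed.

Lemma total_weight_gt0 : 0 < total_weight.
Proof.
rewrite /total_weight (bigD1 [ffun=> true]) //= ltr_pwDl ?sumr_ge0 //.
by rewrite ltr0n (leq_trans (ltn0Sn k)) // weight_full.
Qed.

Lemma total_weight_le : total_weight <= 2 ^+ k.+1 * k.+1%:R.
Proof.
apply: (@le_trans _ _ (\sum_(x : bits) k.+1%:R)).
  by apply: ler_sum => x _; rewrite ler_nat weight_le.
by rewrite sumr_const card_ffun card_bool card_ord -[leLHS]mulr_natl natrX.
Qed.

Lemma unit_mass_ge0 i : 0 <= unit_mass i.
Proof.
rewrite mulr_ge0 ?invr_ge0 // !mulr_ge0 ?ler0n //.
  exact/ltW/even_count_gt0.
exact/ltW/total_weight_gt0.
Qed.

Lemma cell_sum (a : 'I_N) (H : symbol -> R) :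
  \sum_(i | cell i == a) unit_mass i * H (g i) =
  (N%:R * (even_count * total_weight))^-1 *
    \sum_x \sum_(z | ~~ parity z) H (a, (x, z)).
Proof.
rewrite (bigID (fun i => (f (g i) == i) && ~~ parity (third i))) /=.
rewrite [X in _ + X]big1 ?addr0; last first.
  by move=> i /andP[_ /negbTE mi]; rewrite /unit_mass mi !mul0r.
rewrite (reindex_onto (fun u => f (a, u)) (fun i => (g i).2)) /=; last first.
  move=> i /andP[/eqP ia /andP[/eqP fi _]].
  by rewrite -ia /cell -surjective_pairing.
rewrite pair_big_dep mulr_sumr /=; apply: eq_big => [[x z]|[x z]].
  by rewrite /cell /third fK /= !eqxx /= andbT.
rewrite /unit_mass /cell /third fK /= => /andP[/andP[_ ->] _].
by rewrite mul1r.
Qed.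

Lemma sum_weight_shift (v : bits -> bits) :
  \sum_(x : bits) \sum_(z : bits | ~~ parity z) (weight (x + v z))%:R =
  even_count * total_weight.
Proof.
rewrite exchange_big mulr_suml /=; apply: eq_bigr => z _.
by rewrite mul1r /total_weight [RHS](reindex_inj (addIr (v z))).
Qed.

(** The model and all its relabelings are instances of this family, with
    [v a z = 0] and [v a z = z + r a]. *)
Definition shifted_pmf (v : 'I_N -> bits -> bits) (i : 'I_n) : R :=
  unit_mass i * (weight (base i + v (cell i) (third i)))%:R.

Lemma shifted_cell v a : \sum_(i | cell i == a) shifted_pmf v i = N%:R^-1.
Proof.
rewrite (cell_sum a (fun t => (weight (t.2.1 + v t.1 t.2.2))%:R)) /=.
rewrite (sum_weight_shift (v a)) invfM -mulrA mulVf ?mulr1 //.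
by rewrite mulf_neq0 // gt_eqF ?even_count_gt0 ?total_weight_gt0.
Qed.

Lemma shifted_ge0 v i : 0 <= shifted_pmf v i.
Proof. by rewrite mulr_ge0 ?unit_mass_ge0. Qed.

Lemma shifted_sum1 v : \sum_i shifted_pmf v i = 1.
Proof.
rewrite (partition_big cell xpredT) //=.
under eq_bigr do rewrite shifted_cell.
by rewrite sumr_const card_ord -[LHS]mulr_natl mulfV // pnatr_eq0 -lt0n.
Qed.

Definition shifted v : dist R 'I_n := Dist (shifted_ge0 v) (shifted_sum1 v).

Definition model := shifted (fun _ _ => 0).

Definition relabeled (r : {ffun 'I_N -> bits}) := shifted (fun a z => z + r a).

(** Adding z + r_a twice to x gives back x, so the relabeling is an involution;
    being the identity outside the embedded symbols, it extends to ['I_n]. *)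
Lemma relabeled_perm r : perm_class model (relabeled r).
Proof.
pose tau (t : symbol) : symbol := (t.1, (t.2.1 + (t.2.2 + r t.1), t.2.2)).
have tauK : involutive tau.
  by move=> [a [x z]]; rewrite /tau /= -addrA cubeDD addr0.
pose sig i := if f (g i) == i then f (tau (g i)) else i.
have sigK : involutive sig.
  move=> i; case fi : (f (g i) == i); rewrite /sig fi ?fi //.
  by rewrite fK eqxx tauK (eqP fi).
exists (perm (inv_inj sigK)) => i; rewrite permE /= /shifted_pmf addr0.
rewrite /base /unit_mass /third /cell /sig.
case fi : (f (g i) == i); last by rewrite fi !mul0r.
by rewrite !fK /= eqxx.
Qed.

(** The unnormalized distance to the model when all shifts have parity [b]; it
    is proportional to the mean of | |x| - |y| | over the pairs whose parities
    differ by [b]. *)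
Definition layer (b : bool) : R :=
  \sum_(x : bits) \sum_(y : bits | parity y == b)
     `|(weight (x + y))%:R - (weight x)%:R|.

Definition layer_dist (b : bool) : R :=
  2^-1 * ((even_count * total_weight)^-1 * layer b).

(** The third component of the symbols makes the distance depend on the parity
    of the shifts only: z + r_a runs over the points of parity [b]. *)
Lemma dTV_relabeled b r : all_parity b r ->
  dTV (relabeled r) model = layer_dist b.
Proof.
move=> /forallP rb; rewrite /dTV /layer_dist; congr (_ * _).
rewrite (partition_big cell xpredT) //=.
transitivity (\sum_(a < N) ((N%:R * (even_count * total_weight))^-1 * layer b)).
  apply: eq_bigr => a _.
  pose H (t : symbol) : R :=
    `|(weight (t.2.1 + (t.2.2 + r t.1)))%:R - (weight t.2.1)%:R|.
  rewrite (eq_bigr (fun i => unit_mass i * H (g i))) => [|i _].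
    rewrite cell_sum; congr (_ * _); apply: eq_bigr => x _.
    rewrite [RHS](reindex_inj (addIr (r a))) /=; apply: eq_bigl => z.
    by rewrite parityD (eqP (rb a)); case: (parity z) b {rb} => [] [].
  rewrite /shifted_pmf addr0 -mulrBr normrM ger0_norm ?unit_mass_ge0 //.
rewrite sumr_const card_ord -[LHS]mulr_natl invfM !mulrA mulfV ?mul1r //.
by rewrite pnatr_eq0 -lt0n.
Qed.

(** With y' = x + y, the difference of the two layers is the sum of
    [sign_energy] over x and y'. *)
Lemma layer_gap : layer false + 2 <= layer true.
Proof.
have := sign_energy R k.
have -> : \sum_(x : bits) \sum_(y : bits) (-1) ^+ parity x * (-1) ^+ parity y
     * `|(weight x)%:R - (weight y)%:R| = layer false - layer true :> R.
  rewrite -sumrB; apply: eq_bigr => x _.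
  rewrite (reindex_inj (addrI x)) /= (bigID (fun y => parity y == false)) /=.
  congr (_ + _); last rewrite -sumrN.
    apply: eq_bigr => y /eqP py; rewrite parityD py addbF -signr_addb addbb.
    by rewrite mul1r distrC.
  apply: eq_big => y; first by case: (parity y).
  case py : (parity y) => // _.
  by rewrite parityD py addbT -signr_addb addbN addbb expr1 mulN1r distrC.
by move=> h; lra.
Qed.

Lemma layer_dist_gap :
  layer_dist false + (k.+1%:R * 4 ^+ k.+1)^-1 <= layer_dist true.
Proof.
have E0 := even_count_gt0; have W0 := total_weight_gt0.
have EW0 : 0 < even_count * total_weight by rewrite mulr_gt0.
have le : (k.+1%:R * 4 ^+ k.+1)^-1 <= (even_count * total_weight)^-1.
  rewrite lef_pV2 ?posrE ?mulr_gt0 ?exprn_gt0 //.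
  have -> : 4 = 2 * 2 :> R by lra.
  rewrite exprMn mulrCA mulrA [leRHS]mulrAC -mulrA.
  rewrite mulrC [leRHS]mulrC.
  apply: ler_pM; rewrite ?(ltW E0) ?(ltW W0) ?even_count_le //.
  exact: total_weight_le.
apply: le_trans (_ : layer_dist false + (even_count * total_weight)^-1 <= _).
  by rewrite lerD2l.
rewrite /layer_dist; have := layer_gap.
have := EW0; rewrite -invr_gt0; move: (_^-1) => u u0 gap; nra.
Qed.

End HardInstance.

(** * The lower bound in terms of the number of cells *)

Lemma dTV_le1 (R : realType) (n : nat) (p q : dist R 'I_n) : dTV p q <= 1.
Proof.
suff : \sum_i `|p i - q i| <= 2 by rewrite /dTV => h; lra.
apply: (@le_trans _ _ (\sum_i (p i + q i))); last first.
  by rewrite big_split /= !dist_sum1.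
apply: ler_sum => i _; rewrite (le_trans (ler_normB _ _)) //.
by rewrite !ger0_norm ?dist_ge0.
Qed.

(** The threshold lies delta above the distance of the even relabelings: the gap
    of more than 2 delta leaves the odd ones strictly beyond the threshold plus
    delta, while the threshold stays positive even if the even distance is 0. *)
Lemma moment_bound (R : realType) (n N k : nat) (delta : R) :
  (0 < N)%N -> (N * 4 ^ k.+1 <= n)%N -> 0 < delta ->
  2 * delta < (k.+1%:R * 4 ^+ k.+1)^-1 ->
  exists (eps : R) (q : dist R 'I_n), 0 < eps <= 1 /\
  forall (s : nat) (A : algorithm R n s), distinguishes q eps delta A ->
  N%:R ^+ k <= 3 * s%:R ^+ k.+1 :> R.
Proof.
move=> N0 Nn d0 small.
have t0 : 'I_N * (cube k.+1 * cube k.+1) :=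
  (Ordinal N0, ([ffun=> false], [ffun=> false])).
have card : (#|{: 'I_N * (cube k.+1 * cube k.+1)}| <= n)%N.
  rewrite !card_prod card_ord !card_ffun card_bool card_ord.
  by rewrite -expnMn.
have [f [g fK]] := finite_encoding t0 card.
have gap := layer_dist_gap R k.
set g0 := (_ * _)^-1 in small gap.
have dTV0 : 0 <= layer_dist R k false.
  rewrite -(dTV_relabeled R (b := false) N0 fK (r := [ffun=> [ffun=> false]])).
    by rewrite /dTV mulr_ge0 ?invr_ge0 ?sumr_ge0.
  by apply/forallP => a; rewrite ffunE /parity big1 // => i _; rewrite ffunE.
have dTV1 : layer_dist R k true <= 1.
  rewrite -(dTV_relabeled R (b := true) N0 fK (r := [ffun=> axis ord0])).
    exact: dTV_le1.
  by apply/forallP => a; rewrite ffunE parity_axis.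
exists (layer_dist R k false + delta), (model R N0 fK); split.
  by apply/andP; split; lra.
move=> s A disA.
apply: (sample_lower_bound (m := unit_mass R f g) (P := relabeled R N0 fK)
   (c := fun i => (g i).1) (y := fun i => (g i).2.1 + (g i).2.2)
   (A := A)) => //.
- by move=> r i; rewrite /= /shifted_pmf addrA.
- by move=> r a; apply: shifted_cell.
- move=> r /(dTV_relabeled R N0 fK) rE.
  have [yes _] := disA _ (relabeled_perm R N0 fK r).
  by apply: yes; rewrite rE; lra.
- move=> r /(dTV_relabeled R N0 fK) rE.
  have [_ no] := disA _ (relabeled_perm R N0 fK r).
  by apply: no; rewrite rE; lra.
Qed.

(** * One sample is always needed *)

Lemma prob_output_nosample (R : realType) (n : nat) (A : algorithm R n 0)
    (p q : dist R 'I_n) (b : bool) :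
  prob_output A p b = prob_output A q b.
Proof. by apply: eq_bigr => w _; rewrite !big_ord0. Qed.

Lemma prob_output_sum1 (R : realType) (n s : nat) (A : algorithm R n s)
    (p : dist R 'I_n) : prob_output A p true + prob_output A p false = 1.
Proof.
rewrite -(samples_sum1 s p) -big_split /=; apply: eq_bigr => w _.
by rewrite -mulrDr answer_sum1 mulr1.
Qed.

Lemma point_mass_sum1 (R : realType) (T : finType) (a : T) :
  \sum_i (i == a)%:R = 1 :> R.
Proof. by rewrite (bigD1 a) //= eqxx big1 ?addr0 // => i /negbTE ->. Qed.

Definition point_mass (R : realType) (T : finType) (a : T) : dist R T :=
  Dist (fun i => ler0n R (i == a)) (point_mass_sum1 R a).

(** Two distinct point masses are at distance 1 and are relabelings of each
    other; without samples the algorithm answers both in the same way. *)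
Lemma at_least_one_sample (R : realType) (n : nat) (delta : R) :
  (2 <= n)%N -> 0 < delta < 1 ->
  exists (eps : R) (q : dist R 'I_n), 0 < eps <= 1 /\
  forall (s : nat) (A : algorithm R n s), distinguishes q eps delta A ->
  (0 < s)%N.
Proof.
case: n => [|[|n]] // _ /andP[d0 d1].
pose a : 'I_n.+2 := ord0; pose b : 'I_n.+2 := ord_max.
have ab : b != a by [].
exists ((1 - delta) / 2), (point_mass R a); split; first lra.
case=> // A disA.
have [//|yes _] := disA (point_mass R a).
  by exists 1%g => i; rewrite perm1.
have [//|_ no] := disA (point_mass R b).
  exists (tperm a b) => i; rewrite /= -(inj_eq (@perm_inj _ (tperm a b))).
  by rewrite tpermR.
have dab : dTV (point_mass R b) (point_mass R a) = 1.
  rewrite /dTV (bigD1 a) //= (bigD1 b) //= big1 => [|i /andP[ia ib]].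
    rewrite /= !eqxx /= subr0 sub0r normrN normr1.
    lra.
  by rewrite /= (negbTE ia) (negbTE ib) subr0 normr0.
have {}no : 2 / 3 <= prob_output A (point_mass R b) false.
  by apply: no; rewrite dab; lra.
have {}yes : 2 / 3 <= prob_output A (point_mass R a) true.
  apply: yes; rewrite /dTV big1 ?mulr0 => [|i _].
    lra.
  by rewrite subrr normr0.
have := prob_output_sum1 A (point_mass R b).
rewrite -(prob_output_nosample A (point_mass R a) (point_mass R b) true); lra.
Qed.

(** * Choice of the parameters *)

Lemma truncated_log (R : realType) (x : R) : 16 <= x ->
  exists k : nat, 16 ^+ k.+1 <= x < 16 ^+ k.+2.
Proof.
move=> x16; have x0 : 0 <= x by lra.
have [m mx] : exists m, x < 16 ^+ m.
  exists (Num.bound x); apply: lt_trans (archi_boundP x0) _.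
  by rewrite -natrX ltr_nat ltn_expl.
elim: m mx => [|m IH] mx; first by move: mx; rewrite expr0; lra.
case: (ltP x (16 ^+ m)) => [/IH //|mx'].
case: m mx mx' {IH} => [|m] mx mx'; first by move: mx; rewrite expr1; lra.
by exists m; rewrite mx'.
Qed.

Theorem theorem4p2 (R : realType) :
  exists C c : R, 0 < C /\ 0 < c /\
  forall (n : nat) (delta : R), (2 <= n)%N -> 0 < delta < 1 ->
  exists (eps : R) (q : dist R 'I_n), 0 < eps <= 1 /\
  forall (s : nat) (A : algorithm R n s), distinguishes q eps delta A ->
  c * delta ^+ 2 * n%:R `^ (1 - C / log2 (1 / delta)) <= s%:R.
Proof.
exists 8, 6^-1; split=> //; split=> [|n delta n2 d01].
  by rewrite invr_gt0.
set T := _ * _ `^ _.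
have [T1 | T1] := leP T 1.
  have [eps [q [eps01 Hq]]] := at_least_one_sample n2 d01.
  exists eps, q; split=> // s A /Hq s0.
  by rewrite (le_trans T1) // ler1n.
have n0 : (0 < n)%N by apply: ltn_trans n2.
have n1 : 1 <= n%:R :> R by rewrite ler1n.
have /andP[d0 d1] := d01.
have dd1 : delta ^+ 2 <= 1 by nra.
set L := log2 (1 / delta) in T T1 *.
have ln2 : 0 < ln 2 :> R by apply: ln_gt0; rewrite ltr1n.
have L0 : 0 < L.
  by rewrite divr_gt0 // ln_gt0 // ltr_pdivlMr // mul1r.
have powle e : e <= 1 -> n%:R `^ e <= n%:R :> R.
  by move=> e1; rewrite -[leRHS]powRr1 ?ler_powR.
(* Both regimes excluded here make the bound at most 1: few symbols, or large
   delta. *)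
have nd : 1 < delta ^+ 2 * n%:R.
  have En : n%:R `^ (1 - 8 / L) <= n%:R.
    by apply: powle; rewrite gerBl divr_ge0 ?(ltW L0).
  have := ler_wpM2l (sqr_ge0 delta) En.
  by move: T1; rewrite /T -mulrA; lra.
have L8 : 8 < L.
  rewrite ltNge; apply/negP => L8; move: T1; apply/negP; rewrite -leNgt /T.
  have : n%:R `^ (1 - 8 / L) <= 1 :> R.
    rewrite -[leRHS](powRr0 (n%:R : R)) ler_powR // subr_le0.
    by rewrite ler_pdivlMr // mul1r.
  move=> E1; have := mulr_ile1 (sqr_ge0 delta) (powR_ge0 _ _) dd1 E1.
  by rewrite -mulrA; lra.
have x16 : 16 <= 1 / delta.
  rewrite -ler_ln ?posrE ?divr_gt0 //; apply: ltW.
  have -> : 16 = 2 ^+ 4 :> R by rewrite -natrX.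
  rewrite lnXn // -[ln 2 *+ 4]mulr_natl -ltr_pdivlMr //.
  by apply: lt_trans L8; rewrite ltr_nat.
(* The cube has dimension K = k + 1.  The base 16 leaves room for 2 K 4^K, twice
   the inverse of the gap; the upper estimate makes K at least L / 8. *)
have [k /andP[le16 lt16]] := truncated_log x16.
have L4 : L < 4 * k.+2%:R.
  move: lt16; rewrite -ltr_ln ?posrE ?divr_gt0 ?exprn_gt0 //.
  have -> : 16 = 2 ^+ 4 :> R by rewrite -natrX.
  by rewrite -exprM lnXn // -[ln 2 *+ _]mulr_natl -ltr_pdivrMr // natrM.
have d16 : delta * 16 ^+ k.+1 <= 1.
  by rewrite mulrC -ler_pdivlMr.
have small : 2 * delta < (k.+1%:R * 4 ^+ k.+1)^-1.
  rewrite -[ltRHS]mul1r ltr_pdivlMr ?mulr_gt0 ?exprn_gt0 //.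
  apply: lt_le_trans d16; rewrite [2 * _]mulrC -mulrA ltr_pM2l // -!natrX.
  rewrite -!natrM ltr_nat -[16%N]/(4 * 4)%N expnMn mulnA.
  rewrite ltn_pmul2r ?expn_gt0 // -[4%N]/(2 * 2)%N expnMn.
  apply: (@leq_trans (2 * k.+2)); first by rewrite ltn_pmul2l.
  apply: leq_mul; last exact: ltn_expl.
  by rewrite -[leqLHS]expn1 leq_exp2l.
have d4 : delta ^+ 2 * 4 ^+ k.+1 <= 1.
  apply: le_trans d16; apply: ler_pM; rewrite ?sqr_ge0 ?exprn_ge0 //.
    by rewrite expr2 ler_piMl // ltW.
  by rewrite lerXn2r ?nnegrE // ler_nat.
set B := (4 ^ k.+1)%N.
have B0 : (0 < B)%N by rewrite expn_gt0.
have BE : B%:R = 4 ^+ k.+1 :> R by rewrite natrX.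
have Bn : (B <= n)%N.
  rewrite -(ler_nat R) BE -(ler_pM2l (exprn_gt0 2 d0)).
  exact: le_trans d4 (ltW nd).
set N := (n %/ B)%N.
have N0 : (0 < N)%N by rewrite divn_gt0.
have NBn : (N * B <= n)%N by apply: leq_trunc_div.
have nNB : n%:R <= 2 * 4 ^+ k.+1 * N%:R :> R.
  rewrite -BE -!natrM ler_nat (leq_trans (ltnW (ltn_ceil n B0))) // -/N.
  by rewrite mulnAC leq_mul2r mul2n -addnn -addn1 leq_add2l N0 orbT.
have [eps [q [eps01 Hq]]] := moment_bound N0 NBn d0 small.
exists eps, q; split=> // s A /Hq Ns.
set E := n%:R `^ _ in T T1 *.
(* The exponent of n is at most 1 - 1 / K because 8 K >= L. *)
have EK : E ^+ k.+1 <= n%:R ^+ k.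
  rewrite -powR_mulrn ?powR_ge0 // -powRrM -powR_mulrn // ler_powR //.
  have : L <= 8 * k.+1%:R.
    apply: ltW; apply: lt_le_trans L4 _; rewrite -!natrM ler_nat.
    rewrite -[8%N]/(4 * 2)%N -mulnA leq_mul2l.
    by rewrite mul2n -addnn addSn ltnS leq_addl.
  rewrite mulrBl mul1r mulrAC => h; rewrite -[k.+1]addn1 natrD.
  have : 1 <= 8 * k.+1%:R / L by rewrite ler_pdivlMr // mul1r.
  by rewrite -[k.+1]addn1 natrD; lra.
have base_ge0 : 0 <= 6^-1 * delta ^+ 2 * n%:R.
  by rewrite mulr_ge0 // mulr_ge0 ?invr_ge0 ?sqr_ge0.
(* Here delta ^+ 2 pays for the 4 ^+ k.+1 symbols of a cell. *)
have base : 6^-1 * delta ^+ 2 * n%:R <= N%:R.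
  have := ler_wpM2l (sqr_ge0 delta) nNB.
  have := ler_wpM2r (ler0n R N) d4.
  rewrite mul1r mulrA [delta ^+ 2 * (2 * _)]mulrCA -[2 * _ * N%:R]mulrA -mulrA.
  have := ler0n R N; lra.
have : T ^+ k.+1 <= 6^-1 * N%:R ^+ k.
  rewrite /T -/E exprMn.
  apply: le_trans (_ : (6^-1 * delta ^+ 2) ^+ k.+1 * n%:R ^+ k <= _).
    by apply: ler_wpM2l EK; rewrite exprn_ge0 // mulr_ge0 ?invr_ge0 ?sqr_ge0.
  rewrite exprS -mulrA -exprMn; apply: ler_pM.
  - by rewrite mulr_ge0 ?invr_ge0 ?sqr_ge0.
  - exact: exprn_ge0.
  - by rewrite ler_piMr ?invr_ge0.
  - by rewrite lerXn2r ?nnegrE.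
have : 0 <= N%:R ^+ k :> R by rewrite exprn_ge0.
move=> Nk0 TN; rewrite -(@ler_pXn2r _ k.+1) ?nnegrE ?ler0n //.
  lra.
exact: le_trans (ltW T1).
Qed.
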